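(* Let $\Delta\subset\mathbb{R}^2$ be a triangle and let $\rho_\Delta$ be the radius of its maximal inscribed circle. For any $\delta\in(0,\rho_\Delta/2)$, set $\Delta_\delta=\{x\in\Delta:\mathrm{dist}(x,\partial\Delta)>\delta\}$. Let $p\ge 1$ be an integer. Then for any $v\in Q_p(\Delta)$, $$\|v\|_{L^2(\Delta)}\le\left(1+7\sqrt{\delta/\rho_\Delta}\right)^{2p+3/2}\|v\|_{L^2(\Delta_\delta)}.$$
   Context: $Q_p(\Delta)$ denotes the restrictions to $\Delta$ of all real polynomials in $(x_1,x_2)$ of degree at most $p$ in each variable separately. $\mathrm{dist}(x,\partial\Delta)$ is the Euclidean distance of $x$ to $\partial\Delta$. *)

(* Defs.v *)
From HB Require Import structures.
From mathcomp Require Import all_boot all_order all_algebra.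
From mathcomp Require Import all_classical all_reals all_analysis.

Set Implicit Arguments.
Unset Strict Implicit.
Unset Printing Implicit Defensive.

Import Order.TTheory GRing.Theory Num.Theory.
Import numFieldNormedType.Exports.

Local Open Scope classical_set_scope.
Local Open Scope ring_scope.

(* The library norm on R * R is the sup norm, hence the explicit formula. *)
Definition edist (R : realType) (x y : R * R) : R :=
  Num.sqrt ((x.1 - y.1) ^+ 2 + (x.2 - y.2) ^+ 2).

Definition set_edist (R : realType) (x : R * R) (A : set (R * R)) : R :=
  inf [set edist x y | y in A].

(* The topology of R * R is the Euclidean one, the two norms being equivalent. *)
Definition boundary (T : topologicalType) (A : set T) : set T :=
  closure A `\` A°.

Definition collinear (R : realType) (a b c : R * R) : Prop :=
  exists p d : R * R, exists s t u : R,
    [/\ a = p + s *: d, b = p + t *: d & c = p + u *: d].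

Definition triangle_hull (R : realType) (a b c : R * R) : set (R * R) :=
  [set x | exists s t u : R, [/\ 0 <= s, 0 <= t, 0 <= u, s + t + u = 1 &
                                 x = s *: a + t *: b + u *: c]].

Definition is_triangle (R : realType) (D : set (R * R)) : Prop :=
  exists a b c : R * R, ~ collinear a b c /\ D = triangle_hull a b c.

Definition inradius (R : realType) (D : set (R * R)) : R :=
  sup [set r : R | 0 <= r /\
         exists o : R * R, [set x | edist x o <= r] `<=` D].

Definition inner_set (R : realType) (D : set (R * R)) (delta : R) :
    set (R * R) :=
  [set x | D x /\ delta < set_edist x (boundary D)].

(* A nonzero P has degree size P - 1 in x.1 and sizeY P - 1 in x.2. Only the
   values of v on D matter, v standing for its restriction to D. *)
Definition Qp (R : realType) (p : nat) (D : set (R * R)) (v : R * R -> R) :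
    Prop :=
  exists P : {poly {poly R}},
    [/\ (size P <= p.+1)%N, (sizeY P <= p.+1)%N &
        forall x, D x -> v x = P.[x.1, x.2]].

Definition lebesgue2 (R : realType) :
    {measure set (measurableTypeR R * measurableTypeR R) -> \bar R} :=
  (@lebesgue_measure R \x @lebesgue_measure R)%E.

(* Restriction extends by [point], which is 0 in \bar R. *)
Definition L2norm (R : realType) (A : set (R * R)) (v : R * R -> R) : \bar R :=
  'N[lebesgue2 R]_(2%:E)[(EFin \o v) \_ A].

(* Main.v *)
(* Let B(o, r) be a disk in the triangle D, with r close to the inradius rho,
   and let D' be the image of D under the homothety of centre o and ratio l,
   where (1 - l) r > delta. Convexity puts D' inside the inner set. Restricted
   to the ray from o through x, the function t |-> t^2 v(o + t (x - o))^2 is a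
   polynomial of degree at most n = 4p + 2, so its value at t = 1 is bounded by
   a positive combination of its values at the Chebyshev nodes t_k of [0, l],
   with total weight T_n(2/l - 1). Integrating over x in D, the factor t_k^2 is
   the Jacobian of the homothety of ratio t_k, which maps D into D'. So the
   integral of v^2 over D is at most T_n(2/l - 1) times that over D'. For
   s = sqrt(delta / rho), z = 1 + 7 s and l = 4 z / (z + 1)^2, the number
   2/l - 1 is (z + 1/z) / 2, at which T_n is at most z^n, while 1 - l > s^2
   because s < 5/7. *)
Require Import Defs.
From HB Require Import structures.
From mathcomp Require Import all_boot all_order all_algebra.
From mathcomp Require Import all_classical all_reals all_analysis.
From mathcomp Require Import measurable_realfun ring lra zify.

Import Order.TTheory GRing.Theory Num.Theory.
Import numFieldNormedType.Exports.

Local Open Scope classical_set_scope.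
Local Open Scope ring_scope.

(** * Chebyshev extrapolation *)

Fixpoint chebyshev (R : realType) (n : nat) : {poly R} :=
  match n with
  | 0 => 1
  | 1 => 'X
  | (m.+1 as k).+1 => 'X *+ 2 * chebyshev R k - chebyshev R m
  end.

Lemma chebyshevSS (R : realType) n :
  chebyshev R n.+2 = 'X *+ 2 * chebyshev R n.+1 - chebyshev R n.
Proof. by []. Qed.

Lemma size_chebyshev (R : realType) n : (size (chebyshev R n) <= n.+1)%N.
Proof.
suff: (size (chebyshev R n) <= n.+1)%N /\ (size (chebyshev R n.+1) <= n.+2)%N.
  by case.
elim: n => [|n [IH0 IH1]]; first by rewrite /= size_poly1 size_polyX.
split=> //; rewrite chebyshevSS (leq_trans (size_polyD _ _))// geq_max.
apply/andP; split; last by rewrite size_polyN (leq_trans IH0)// ltnW.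
rewrite mulrnAl -scaler_nat (leq_trans (size_scale_leq _ _))// mulrC.
by rewrite (leq_trans (size_polyMleq _ _))// size_polyX addn2.
Qed.

Lemma chebyshev_cos (R : realType) n (a : R) :
  (chebyshev R n).[cos a] = cos (n%:R * a).
Proof.
suff: (chebyshev R n).[cos a] = cos (n%:R * a) /\
      (chebyshev R n.+1).[cos a] = cos (n.+1%:R * a) by case.
elim: n => [|n [IH0 IH1]].
  by rewrite /= hornerX hornerC mulr0n mul0r mul1r cos0.
split=> //; rewrite chebyshevSS hornerD hornerN hornerM hornerMn hornerX IH0 IH1.
have -> : n.+2%:R * a = n.+1%:R * a + a by rewrite -natr1 mulrDl mul1r.
have -> : n%:R * a = n.+1%:R * a - a by rewrite -natr1 mulrDl mul1r addrK.
rewrite cosB cosD; ring.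
Qed.

(** Gives T_n beyond 1, as [chebyshev_cos] gives it on [-1, 1]: the powers of [z] and of [z^-1] both
    solve the three-term recurrence, whose coefficient 2X is here [z + z^-1]. *)
Lemma chebyshev_joukowski (R : realType) n (z : R) : z != 0 ->
  (chebyshev R n).[(z + z^-1) / 2] = (z ^+ n + z^-1 ^+ n) / 2.
Proof.
move=> z0.
suff: (chebyshev R n).[(z + z^-1) / 2] = (z ^+ n + z^-1 ^+ n) / 2 /\
      (chebyshev R n.+1).[(z + z^-1) / 2] = (z ^+ n.+1 + z^-1 ^+ n.+1) / 2.
  by case.
elim: n => [|n [IH0 IH1]].
  by rewrite /= !hornerE !expr0 !expr1; split => //; field.
split=> //; rewrite chebyshevSS hornerD hornerN hornerM hornerMn hornerX IH0 IH1.
by rewrite !exprS; field.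
Qed.

Lemma cos_natpi (R : realType) n : cos (n%:R * pi) = (-1) ^+ n :> R.
Proof.
elim: n => [|n IH]; first by rewrite mul0r cos0.
by rewrite -natr1 mulrDl mul1r cosDpi IH exprSr mulrN1.
Qed.

(** Lagrange interpolation at the extrema cos(k pi / n) of T_n, with the absolute values of the
    basis polynomials at X = (z + 1/z) / 2 as weights. Since X > 1, these values alternate in sign
    with k exactly as T_n does at the nodes, so the weights sum to T_n(X). *)
Lemma chebyshev_extrapolation (R : realType) (n : nat) (z : R) :
  (0 < n)%N -> 1 < z ->
  exists (y w : 'I_n.+1 -> R),
    [/\ forall k, -1 <= y k <= 1, forall k, 0 <= w k, \sum_k w k <= z ^+ n &
        forall g : {poly R}, (size g <= n.+1)%N ->
          g.[(z + z^-1) / 2] <= \sum_k w k * `|g.[y k]| ].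
Proof.
move=> n0 z1.
have z0 : 0 < z by lra.
set X := (z + z^-1) / 2.
have X1 : 1 < X.
  have zv : z * z^-1 = 1 by rewrite divff// gt_eqF.
  have vl : 0 < z^-1 by rewrite invr_gt0.
  rewrite /X; nra.
pose a k : R := k%:R * (pi / n%:R).
have n0R : 0 < n%:R :> R by rewrite ltr0n.
have pi0 := pi_gt0 R.
have a_in k : (k <= n)%N -> a k \in `[0, pi].
  move=> kn; rewrite in_itv /=; apply/andP; split.
    by apply: mulr_ge0 => //; apply: divr_ge0 => //; exact: ltW.
  by rewrite /a mulrCA ger_pMr// ler_pdivrMr// mul1r ler_nat.
have a_lt j k : (j < k)%N -> a j < a k.
  by move=> jk; rewrite /a ltr_pM2r ?ltr_nat// divr_gt0.
(* [lagrange] wants nodes that are injective on all of [nat]. *)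
pose x k : R := if (k <= n)%N then cos (a k) else k.+1%:R.
have x_out k : (n < k)%N -> 1 < x k.
  move=> nk; rewrite /x leqNgt nk /= ltr1n ltnS.
  exact: leq_trans nk.
have x_in k : (k <= n)%N -> x k = cos (a k) by rewrite /x => ->.
have x_le1 k : (k <= n)%N -> -1 <= x k <= 1.
  by move=> kn; rewrite x_in// cos_geN1 cos_le1.
have x_lt j k : (j < k <= n)%N -> x k < x j.
  move=> /andP[jk kn]; have jn : (j <= n)%N by lia.
  by rewrite !x_in// ltr_cos ?a_in// a_lt.
have x_inj : injective x.
  move=> j k; have [jn|nj] := leqP j n; have [kn|nk] := leqP k n.
  - move=> e; have [jk|kj|//] := ltngtP j k.
    + by have := @x_lt j k; rewrite jk kn e ltxx => /(_ isT).
    + by have := @x_lt k j; rewrite kj jn e ltxx => /(_ isT).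
  - by move=> e; case/andP: (x_le1 _ jn) => _; rewrite e leNgt x_out.
  - by move=> e; case/andP: (x_le1 _ kn) => _; rewrite -e leNgt x_out.
  - have nj' := nj; move: nj nk; rewrite /x !ltnNge => /negPf -> /negPf ->.
    by move=> /eqP; rewrite eqr_nat => /eqP [].
pose L (k : 'I_n.+1) := (lagrange n.+1 x)`_k : {poly R}.
have interp (g : {poly R}) : (size g <= n.+1)%N ->
    g.[X] = \sum_(k < n.+1) g.[x k] * (L k).[X].
  move=> sg; rewrite {1}(lagrange_gen (ltn0Sn n) x_inj sg) horner_sum.
  by apply: eq_bigr => k _; rewrite hornerM hornerC /L nth_lagrange.
(* The numerator of the basis polynomial is nonnegative at X, which lies to the right of all nodes.
   The nodes decrease, so exactly the k factors [x k - x j] with j < k of the denominator are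
   negative. *)
have sgnL (k : 'I_n.+1) : 0 <= (-1) ^+ k * (L k).[X].
  rewrite /L nth_lagrange lagrangeE//.
  rewrite hornerM hornerC.
  set p := \prod_(_ < _ | _) _.
  have pX : 0 <= p.[X].
    rewrite horner_prod; apply: prodr_ge0 => j _.
    rewrite hornerXsubC subr_ge0 (le_trans _ (ltW X1))//.
    by case/andP: (x_le1 j (ltn_ord j)).
  rewrite mulrA mulr_ge0// -[(-1) ^+ k](@invrK R) -exprVn invrN1 -invfM invr_ge0.
  (* One sign is allotted to each negative factor, so that the product can be treated factor by
     factor. *)
  have -> : (-1) ^+ k = \prod_(j < n.+1 | j != k) (-1) ^+ (j < k)%N :> R.
    rewrite prodrXr; congr (_ ^+ _).
    have := @big_ord_widen nat 0%N addn k n.+1 (fun=> 1%N) (ltnW (ltn_ord k)).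
    rewrite big_const_ord iter_addn_0 mul1n big_mkcond (bigD1 k)//= ltnn add0n => e.
    by rewrite {1}e; apply: eq_bigr => j _; case: ifP.
  rewrite horner_prod -big_split/=; apply: prodr_ge0 => j jk.
  rewrite hornerXsubC; have jkn : (j : nat) != k by [].
  have [lt_jk|lt_kj|e] := ltngtP j k; last by rewrite e eqxx in jkn.
  - rewrite expr1 mulN1r opprB subr_ge0 ltW// x_lt// lt_jk.
    exact: (ltn_ord k).
  - rewrite expr0 mul1r subr_ge0 ltW// x_lt// lt_kj.
    exact: (ltn_ord j).
exists (fun k => x k), (fun k => `|(L k).[X]|); split.
- by move=> k; exact: x_le1 (ltn_ord k).
- by move=> k.
(* Interpolating T_n itself: its value (-1)^k at the k-th node turns each basis value into its
   absolute value. *)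
- have -> : \sum_(k < n.+1) `|(L k).[X]| = (chebyshev R n).[X].
    rewrite interp ?size_chebyshev//; apply: eq_bigr => k _.
    rewrite -[LHS]mul1r -(normr_sign R k) -normrM ger0_norm//; congr (_ * _).
    rewrite (x_in _ (ltn_ord k)) chebyshev_cos /a.
    by rewrite mulrCA [n%:R * _]mulrC mulfVK ?gt_eqF// cos_natpi.
  rewrite chebyshev_joukowski ?gt_eqF//.
  have : z^-1 ^+ n <= z ^+ n.
    rewrite lerXn2r ?nnegrE ?invr_ge0 ?ltW//.
    by rewrite (lt_trans _ z1)// invf_lt1.
  lra.
- move=> g sg; rewrite interp//; apply: ler_sum => k _.
  by rewrite (le_trans (ler_norm _))// normrM mulrC.
Qed.

(** The previous bound transported by the affine map y -> l (1 + y) / 2 from [-1, 1] onto [0, l],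
    where l = 4z / (z + 1)^2 is the length for which X goes to 1. *)
Lemma poly_extrapolation (R : realType) (n : nat) (z : R) :
  (0 < n)%N -> 1 < z ->
  exists (t w : 'I_n.+1 -> R),
    [/\ forall k, 0 <= t k <= 4 * z / (z + 1) ^+ 2,
        forall k, 0 <= w k, \sum_k w k <= z ^+ n &
        forall g : {poly R}, (size g <= n.+1)%N ->
          g.[1] <= \sum_k w k * `|g.[t k]| ].
Proof.
move=> n0 z1; have [y [w [yP w0 wle gP]]] := @chebyshev_extrapolation R n z n0 z1.
set l := 4 * z / (z + 1) ^+ 2.
have z0 : z != 0 by apply/eqP; lra.
have z1' : z + 1 != 0 by apply/eqP; lra.
have l0 : 0 <= l by rewrite divr_ge0 ?sqr_ge0//; lra.
exists (fun k => l / 2 * (1 + y k)), w; split=> //.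
  by move=> k; have /andP[y1 y2] := yP k; apply/andP; split; nra.
move=> g sg.
have := gP (g \Po ((l / 2) *: (1 + 'X))).
rewrite horner_comp hornerZ hornerD hornerX hornerC.
have -> : l / 2 * (1 + (z + z^-1) / 2) = 1.
  rewrite /l; field; exact/andP.
move=> h; apply: (le_trans (h _)).
  rewrite (leq_trans (size_comp_poly_leq _ _))// ltnS.
  rewrite -[leqRHS]muln1 leq_mul//; first by case: (size g) sg.
  have : (size ((l / 2) *: (1 + 'X) : {poly R}) <= 2)%N.
    by rewrite (leq_trans (size_scale_leq _ _))// addrC size_XaddC.
  by case: size => // -[|[]].
rewrite le_eqVlt; apply/orP; left; apply/eqP; apply: eq_bigr => k _.
by rewrite horner_comp hornerZ hornerD hornerX hornerC.
Qed.

(** * Change of variables *)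

(** The pushforward of Lebesgue measure under x -> a + t x, multiplied by t, agrees with Lebesgue
    measure on half-open intervals, hence everywhere by uniqueness. *)
Lemma integral_affine (R : realType) (a t : R)
    (f : measurableTypeR R -> \bar R) : 0 < t ->
  measurable_fun [set: measurableTypeR R] f -> (forall x, (0 <= f x)%E) ->
  (t%:E * \int[@lebesgue_measure R]_x f (a + t * x)%R =
   \int[@lebesgue_measure R]_x f x)%E.
Proof.
move=> t0 mf f0.
pose phi (x : measurableTypeR R) : measurableTypeR R := a + t * x.
have mphi : measurable_fun setT phi.
  by apply: measurable_funD => //; exact: measurable_funM.
pose k : {nonneg R} := NngNum (ltW t0).
pose push : {measure set measurableTypeR R -> \bar R} :=
  measure_function_pushforward__canonical__measure_function_Measure
    (@lebesgue_measure R) mphi.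
pose nu : {measure set measurableTypeR R -> \bar R} := mscale k push.
transitivity (\int[nu]_x f x)%E; last first.
  apply: eq_measure_integral => A mA _; apply/esym.
  apply: lebesgue_measure_unique => // X /ocitvP[->|[[b c] /= bc ->]].
    by rewrite !measure0.
  rewrite /nu /= /mscale /= /pushforward.
  have -> : phi @^-1` `]b, c]%classic = `](b - a) / t, (c - a) / t]%classic.
    apply/seteqP; split=> x /=; rewrite !in_itv /= /phi ltr_pdivrMr// ler_pdivlMr//;
      move=> /andP[h1 h2]; apply/andP; split; nra.
  rewrite !lebesgue_measure_itv /= !lte_fin bc ltr_pM2r ?invr_gt0// ltrD2r bc.
  by rewrite -!EFinB -EFinM; congr EFin; field; rewrite gt_eqF.
rewrite ge0_integral_mscale//; congr (_ * _)%E.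
by rewrite ge0_integral_pushforward.
Qed.

(** By Tonelli, one factor t is absorbed by the outer integral and the other by the inner one. *)
Lemma integral_affine2 (R : realType) (o : R * R) (t : R)
    (f : measurableTypeR R * measurableTypeR R -> \bar R) : 0 < t ->
  measurable_fun [set: measurableTypeR R * measurableTypeR R] f ->
  (forall x, (0 <= f x)%E) ->
  ((t ^+ 2)%:E * \int[lebesgue2 R]_x f (o.1 + t * x.1, o.2 + t * x.2)%R =
   \int[lebesgue2 R]_x f x)%E.
Proof.
move=> t0 mf f0.
have mg : measurable_fun [set: measurableTypeR R * measurableTypeR R]
    (fun x => f (o.1 + t * x.1, o.2 + t * x.2)%R).
  apply: (measurableT_comp mf); apply/measurable_fun_pairP; split => /=.
    apply: measurable_funD => //; apply: measurable_funM => //.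
  apply: measurable_funD => //; apply: measurable_funM => //.
rewrite /lebesgue2 (fubini_tonelli1 _ mf)// (fubini_tonelli1 _ mg)//.
have mF : measurable_fun setT (fubini_F (@lebesgue_measure R) f).
  exact: measurable_fun_fubini_tonelli_F.
have mG : measurable_fun [set: measurableTypeR R] (fubini_F (@lebesgue_measure R)
    (fun x : measurableTypeR R * measurableTypeR R =>
      f (o.1 + t * x.1, o.2 + t * x.2)%R)).
  exact: measurable_fun_fubini_tonelli_F.
rewrite -(integral_affine _ o.1 _ _ t0 mF); last by move=> x; exact: integral_ge0.
rewrite expr2 EFinM -muleA; congr (_ * _)%E.
rewrite -ge0_integralZl_EFin//; last 2 first.
- by move=> x _; exact: integral_ge0.
- exact: ltW.
apply: eq_integral => x _; rewrite /fubini_F.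
apply: (integral_affine _ o.2 t (fun y => f (o.1 + t * x, y)%R)) => //.
exact: (measurableT_comp mf (pair1_measurable _)).
Qed.

Definition homothety (R : realType) (o : R * R) (t : R) (x : R * R) : R * R :=
  ((1 - t) * o.1 + t * x.1, (1 - t) * o.2 + t * x.2).

Lemma homothety1 (R : realType) (o x : R * R) : homothety R o 1 x = x.
Proof. by rewrite /homothety subrr !mul0r !add0r !mul1r -surjective_pairing. Qed.

Lemma homothetyM (R : realType) (o x : R * R) (s t : R) :
  homothety R o s (homothety R o t x) = homothety R o (s * t) x.
Proof. by rewrite /homothety /=; congr (_, _); ring. Qed.

Lemma measurable_homothety (R : realType) (o : R * R) (t : R) :
  measurable_fun [set: measurableTypeR R * measurableTypeR R]
    (homothety R o t : measurableTypeR R * measurableTypeR R ->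
                       measurableTypeR R * measurableTypeR R).
Proof.
apply/measurable_fun_pairP; split => /=.
  by apply: measurable_funD => //; exact: measurable_funM.
by apply: measurable_funD => //; exact: measurable_funM.
Qed.

(** * Bivariate polynomials along a line *)

Lemma horner2E (R : comNzRingType) (P : {poly {poly R}}) (x y : R) :
  P.[x, y] = \sum_(i < size P) (P`_i : {poly R}).[y] * x ^+ i.
Proof.
rewrite [P.[x%:P]]horner_coef horner_sum; apply: eq_bigr => i _.
by rewrite hornerM -polyC_exp hornerC.
Qed.

Lemma measurable_horner2 (R : realType) (P : {poly {poly R}}) :
  measurable_fun [set: measurableTypeR R * measurableTypeR R]
    (fun x : measurableTypeR R * measurableTypeR R => P.[x.1, x.2] : R).
Proof.
under eq_fun do rewrite horner2E.
apply: measurable_sum => i; apply: measurable_funM.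
  apply: (measurableT_comp (f := horner (P`_i : {poly R}))).
    exact: measurable_poly.
  exact: measurable_snd.
exact: measurable_funX.
Qed.

(** Degree p in each variable gives degree at most 2p along a line, since both coordinates of the
    homothety are affine in t. *)
Lemma horner2_homothety (R : realType) (p : nat) (P : {poly {poly R}})
    (o x : R * R) :
  (size P <= p.+1)%N -> (sizeY P <= p.+1)%N ->
  exists2 h : {poly R}, (size h <= (2 * p).+1)%N &
    forall t, h.[t] = P.[(homothety R o t x).1, (homothety R o t x).2].
Proof.
move=> sP sYP.
pose lin (a b : R) : {poly R} := a%:P + (b - a) *: 'X.
have slin a b : (size (lin a b) <= 2)%N.
  rewrite (leq_trans (size_polyD _ _))// geq_max (leq_trans (size_polyC_leq1 _))//.
  by rewrite (leq_trans (size_scale_leq _ _))// size_polyX.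
have linE a b t : (lin a b).[t] = (1 - t) * a + t * b.
  by rewrite hornerD hornerC hornerZ hornerX; ring.
exists (\sum_(i < size P) ((P`_i : {poly R}) \Po lin o.2 x.2) * lin o.1 x.1 ^+ i).
  rewrite (leq_trans (size_sum _ _ _))//; apply/bigmax_leqP => i _.
  rewrite (leq_trans (size_polyMleq _ _))//.
  have s1 : (size ((P`_i : {poly R}) \Po lin o.2 x.2) <= p.+1)%N.
    rewrite (leq_trans (size_comp_poly_leq _ _))// ltnS.
    rewrite -[leqRHS]muln1 leq_mul//.
      have := leq_trans (max_size_coefXY P i) sYP.
      by case: size.
    by case: size (slin o.2 x.2) => // -[|[]].
  have s2 : (size (lin o.1 x.1 ^+ i) <= p.+1)%N.
    rewrite (leq_trans (size_poly_exp_leq _ _))// ltnS.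
    have ip : (i <= p)%N by rewrite -ltnS (leq_trans (ltn_ord i)).
    rewrite -[leqRHS]mul1n leq_mul//.
    by case: size (slin o.1 x.1) => // -[|[]].
  lia.
move=> t; rewrite horner_sum horner2E; apply: eq_bigr => i _.
by rewrite hornerM horner_comp horner_exp !linE.
Qed.

(** * Geometry of the triangle *)

Lemma triangle_hull_homothety (R : realType) (a b c o x : R * R) (t : R) :
  0 <= t <= 1 -> triangle_hull a b c o -> triangle_hull a b c x ->
  triangle_hull a b c (homothety R o t x).
Proof.
move=> /andP[t0 t1] [s1 [s2 [s3 [h1 h2 h3 hs ->]]]].
move=> [u1 [u2 [u3 [k1 k2 k3 ks ->]]]].
exists ((1 - t) * s1 + t * u1), ((1 - t) * s2 + t * u2), ((1 - t) * s3 + t * u3).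
split; try by rewrite addr_ge0// mulr_ge0// subr_ge0.
  transitivity ((1 - t) * (s1 + s2 + s3) + t * (u1 + u2 + u3)); first by ring.
  by rewrite hs ks; ring.
by rewrite /homothety; congr pair => /=; rewrite /GRing.scale /=; ring.
Qed.

(** Twice the signed area of the triangle a, b, x. *)
Definition cross (R : realType) (a b x : R * R) : R :=
  (b.1 - a.1) * (x.2 - a.2) - (b.2 - a.2) * (x.1 - a.1).

Lemma cross_eq0_collinear (R : realType) (a b c : R * R) :
  cross R a b c = 0 -> collinear a b c.
Proof.
move: a b c => [a1 a2] [b1 b2] [c1 c2]; rewrite /cross /= => e.
have [b1a|b1a] := eqVneq b1 a1; last first.
  exists (a1, a2), (b1 - a1, b2 - a2), 0, 1, ((c1 - a1) / (b1 - a1)).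
  have h : b1 - a1 != 0 by rewrite subr_eq0.
  have e' : c2 - a2 = (c1 - a1) / (b1 - a1) * (b2 - a2).
    by apply: (mulfI h); rewrite mulrCA mulrA divfK//; lra.
  split; congr pair => /=; rewrite /GRing.scale /= ?divfK//; lra.
have [b2a|b2a] := eqVneq b2 a2.
  exists (a1, a2), (c1 - a1, c2 - a2), 0, 0, 1.
  by split; congr pair => /=; rewrite /GRing.scale /= ?b1a ?b2a; ring.
exists (a1, a2), (0, 1), 0, (b2 - a2), (c2 - a2).
have c1a : c1 = a1.
  move: e; rewrite b1a subrr mul0r sub0r => /eqP.
  by rewrite oppr_eq0 mulf_eq0 !subr_eq0 (negPf b2a) /= => /eqP.
by split; congr pair => /=; rewrite /GRing.scale /= ?b1a ?c1a; ring.
Qed.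

(** Barycentric coordinates are quotients of signed areas. This presents the triangle as an
    intersection of three half-planes, from which its measurability follows. *)
Lemma triangle_hullE (R : realType) (a b c : R * R) : ~ collinear a b c ->
  triangle_hull a b c = [set x | 0 <= cross R a x c / cross R a b c] `&`
    [set x | 0 <= cross R a b x / cross R a b c] `&`
    [set x | 0 <= cross R b c x / cross R a b c].
Proof.
move=> ncol; have d0 : cross R a b c != 0.
  by apply/eqP => /cross_eq0_collinear.
apply/seteqP; split.
  move=> x [s [t [u [s0 t0 u0 stu ->]]]].
  have -> : s = 1 - t - u by lra.
  have e1 : cross R a ((1 - t - u) *: a + t *: b + u *: c) c = t * cross R a b c.
    by rewrite /cross /= /GRing.scale /=; ring.
  have e2 : cross R a b ((1 - t - u) *: a + t *: b + u *: c) = u * cross R a b c.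
    by rewrite /cross /= /GRing.scale /=; ring.
  have e3 : cross R b c ((1 - t - u) *: a + t *: b + u *: c) =
      (1 - t - u) * cross R a b c.
    by rewrite /cross /= /GRing.scale /=; ring.
  rewrite /= e1 e2 e3 !mulfK//; split; first by split.
  lra.
move=> x [[/= t0 u0] s0].
exists (cross R b c x / cross R a b c), (cross R a x c / cross R a b c),
  (cross R a b x / cross R a b c); split=> //.
  (* The three signed areas add up to that of the whole triangle. *)
  by rewrite -!mulrDl; apply: (mulIf d0); rewrite divfK// /cross; ring.
move: d0; rewrite [x]surjective_pairing /cross => d0.
by congr pair; rewrite /= /GRing.scale /=; field.
Qed.

Lemma measurable_triangle_hull (R : realType) (a b c : R * R) :
  ~ collinear a b c ->
  measurable (triangle_hull a b c : set (measurableTypeR R * measurableTypeR R)).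
Proof.
move=> ncol; rewrite (triangle_hullE _ _ _ _ ncol).
have mge0 (f : measurableTypeR R * measurableTypeR R -> R) :
    measurable_fun setT f -> measurable [set x | 0 <= f x].
  move=> mf; have -> : [set x | 0 <= f x] = setT `&` f @^-1` `[0, +oo[%classic.
    by rewrite setTI; apply/seteqP; split=> x /=; rewrite in_itv /= andbT.
  exact: mf.
by do 2?apply: measurableI; apply: mge0; apply: measurable_funM => //;
  apply: measurable_funB; apply: measurable_funM; apply: measurable_funB.
Qed.

Lemma boundary_max_fst (R : realType) (D : set (R * R)) (m : R * R) :
  D m -> (forall x, D x -> x.1 <= m.1) -> boundary D m.
Proof.
move=> Dm mmax; split; first exact: subset_closure.
rewrite /interior => /nbhs_ballP[e /= e0 eD].
have : D (m.1 + e / 2, m.2).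
  apply: eD; split => /=; last exact: ballxx.
  by rewrite /ball /= opprD addNKr normrN ger0_norm; lra.
move/mmax => /=; lra.
Qed.

(** Needed because [set_edist] to an empty set would be the default value 0 of [inf]. A vertex with
    the largest first coordinate is a boundary point. *)
Lemma triangle_boundary_neq0 (R : realType) (a b c : R * R) :
  boundary (triangle_hull a b c) !=set0.
Proof.
have bnd (m : R * R) : triangle_hull a b c m ->
    a.1 <= m.1 -> b.1 <= m.1 -> c.1 <= m.1 -> boundary (triangle_hull a b c) m.
  move=> Dm am bm cm; apply: boundary_max_fst => // x [s [t [u [s0 t0 u0 stu ->]]]].
  rewrite /= /GRing.scale /=.
  have -> : m.1 = s * m.1 + t * m.1 + u * m.1 by rewrite -!mulrDl stu mul1r.
  by do !apply: lerD; apply: ler_wpM2l.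
have Da : triangle_hull a b c a.
  by exists 1, 0, 0; rewrite !scale0r scale1r !addr0; split.
have Db : triangle_hull a b c b.
  by exists 0, 1, 0; rewrite !scale0r scale1r !(addr0, add0r); split.
have Dc : triangle_hull a b c c.
  by exists 0, 0, 1; rewrite !scale0r scale1r !add0r; split.
have [ab|ba] := leP a.1 b.1; have [bc|cb] := leP b.1 c.1.
- by exists c; apply: bnd => //; lra.
- by exists b; apply: bnd => //; lra.
- have [ac|ca] := leP a.1 c.1; first by exists c; apply: bnd => //; lra.
  by exists a; apply: bnd => //; lra.
- by exists a; apply: bnd => //; lra.
Qed.

(** A point at distance less than [q] from [y] is interior to D, hence not on the boundary. *)
Lemma edist_boundary_ge (R : realType) (D : set (R * R)) (y : R * R) (q : R) :
  0 < q -> [set z | Defs.edist z y <= q] `<=` D -> boundary D !=set0 ->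
  q <= set_edist y (boundary D).
Proof.
move=> q0 qD [z0 bz0]; apply: lb_le_inf; first by exists (Defs.edist y z0), z0.
move=> _ [z [_ nDz] <-]; rewrite leNgt; apply/negP => zq; apply: nDz.
(* Continuity of the squared Euclidean distance yields a neighbourhood in the product topology. *)
pose f (w : R * R) : R := (y.1 - w.1) ^+ 2 + (y.2 - w.2) ^+ 2.
have cf : {for z, continuous f}.
  have cfst : {for z, continuous (fun w : R * R => y.1 - w.1)}.
    by apply: continuousB; [exact: cst_continuous|exact: cvg_fst].
  have csnd : {for z, continuous (fun w : R * R => y.2 - w.2)}.
    by apply: continuousB; [exact: cst_continuous|exact: cvg_snd].
  exact: continuousD (continuousM cfst cfst) (continuousM csnd csnd).
have fz : f z < q ^+ 2.
  by rewrite -(sqr_sqrtr (_ : 0 <= f z)) ?addr_ge0 ?sqr_ge0//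
    ltrXn2r// nnegrE ?sqrtr_ge0// ltW.
suff : nbhs z D by [].
apply: filterS (cvgr_lt (f z) cf _ fz) => w /= fw; apply: qD => /=.
rewrite -(ger0_norm (ltW q0)) -sqrtr_sqr ler_sqrt ?sqr_ge0//.
by rewrite (le_trans _ (ltW fw))// /f -[w.1 - _]opprB -[w.2 - _]opprB !sqrrN.
Qed.

(** The homothety of centre [x] and ratio 1 - l sends the disk B(o, r) to the disk of radius (1 - l)
    r about the image of [x]. By convexity this disk stays in the triangle, so the image is farther
    than [delta] from the boundary. *)
Lemma homothety_inner_set (R : realType) (a b c o x : R * R) (delta r l : R) :
  0 <= l < 1 -> delta < (1 - l) * r -> 0 < (1 - l) * r ->
  [set y | Defs.edist y o <= r] `<=` triangle_hull a b c ->
  triangle_hull a b c o ->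
  triangle_hull a b c x ->
  inner_set (triangle_hull a b c) delta (homothety R o l x).
Proof.
move=> /andP[l0 l1] dr r0 ballD Do Dx; split.
  by apply: triangle_hull_homothety => //; rewrite l0 ltW.
apply: (lt_le_trans dr); apply: edist_boundary_ge => //; last first.
  exact: triangle_boundary_neq0.
have l1' : 1 - l != 0 by rewrite subr_eq0 gt_eqF.
have l1p : 0 < 1 - l by rewrite subr_gt0.
(* [w] is the preimage of [z] under that homothety; it has to be shown to lie in B(o, r). *)
move=> z /= zr; pose w := homothety R x (1 - l)^-1 z.
have -> : z = homothety R x (1 - l) w by rewrite homothetyM divff// homothety1.
apply: triangle_hull_homothety; [by apply/andP; split; lra|by []|].
apply: ballD => /=.
have -> : Defs.edist w o = (1 - l)^-1 * Defs.edist z (homothety R o l x).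
  rewrite /Defs.edist -[in RHS](@ger0_norm _ (1 - l)^-1) ?invr_ge0 ?ltW//.
  rewrite -sqrtr_sqr -sqrtrM ?sqr_ge0//; congr Num.sqrt.
  by rewrite /w /homothety /=; field.
by rewrite ler_pdivrMl.
Qed.

(** Replaces a disk of maximal radius, so that the supremum need not be shown to be attained.
    Positivity of [x] excludes an empty set of radii, whose [sup] would be 0. *)
Lemma inradius_ball (R : realType) (D : set (R * R)) (x : R) :
  0 < x < inradius D ->
  exists r o, x < r /\ [set y | Defs.edist y o <= r] `<=` D.
Proof.
move=> /andP[x0 xr].
have [|r [ge0r [ctr oD]] xlr] := sup_gt _ xr; last by exists r, ctr.
apply/set0P/eqP => e.
by move: (lt_trans x0 xr); rewrite /inradius e sup0 ltxx.
Qed.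

(** * Comparison of the integrals *)

Lemma sqr_le_sum_homothety (R : realType) (p : nat) (P : {poly {poly R}})
    (z : R) :
  (size P <= p.+1)%N -> (sizeY P <= p.+1)%N -> 1 < z ->
  exists (t w : 'I_(4 * p + 2).+1 -> R),
    [/\ forall k, 0 <= t k <= 4 * z / (z + 1) ^+ 2,
        forall k, 0 <= w k, \sum_k w k <= z ^+ (4 * p + 2) &
        forall o x : R * R, P.[x.1, x.2] ^+ 2 <=
          \sum_k w k * (t k ^+ 2 *
            P.[(homothety R o (t k) x).1, (homothety R o (t k) x).2] ^+ 2) ].
Proof.
move=> sP sYP z1.
have n0 : (0 < 4 * p + 2)%N by lia.
have [t [w [tP w0 wle gP]]] := poly_extrapolation R _ z n0 z1.
exists t, w; split => // o x.
have [h sh hE] := horner2_homothety R p P o x sP sYP.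
(* The square of [h] has degree at most 4p; the factor 'X^2, equal to 1 at t = 1, adds 2 and
   supplies the Jacobian at the nodes. *)
pose g : {poly R} := 'X^2 * h ^+ 2.
have gE t' : g.[t'] =
    t' ^+ 2 * P.[(homothety R o t' x).1, (homothety R o t' x).2] ^+ 2.
  by rewrite hornerM hornerXn horner_exp hE.
have sg : (size g <= (4 * p + 2).+1)%N.
  rewrite (leq_trans (size_polyMleq _ _))// size_polyXn.
  have := size_poly_exp_leq h 2; move: (size (h ^+ 2)) => m.
  by move: sh; case: (size h) => [|q] /=; lia.
have := gP g sg; rewrite gE homothety1 expr1n mul1r => H; apply: (le_trans H).
apply: ler_sum => k _; rewrite gE ger0_norm//.
by rewrite mulr_ge0// sqr_ge0.
Qed.

(* Unlike [ge0_le_integral], this spares proving that the inner set, over which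
   [g] will be supported, is measurable. *)
Lemma nnintegral_le (d : measure_display) (T : measurableType d) (R : realType)
    (mu : {measure set T -> \bar R}) (f g : T -> \bar R) :
  (forall x, 0 <= f x)%E -> (forall x, f x <= g x)%E ->
  (\int[mu]_x f x <= \int[mu]_x g x)%E.
Proof.
move=> f0 fg; have g0 x : (0 <= g x)%E by exact: le_trans (fg x).
rewrite !ge0_integralTE//; apply: le_ereal_sup => _ [h hf <-].
by exists h => // x; exact: le_trans (fg x).
Qed.

Lemma integral_sqr_homothety (R : realType) (p : nat) (P : {poly {poly R}})
    (z : R) (D : set (R * R)) (o : R * R) :
  (size P <= p.+1)%N -> (sizeY P <= p.+1)%N -> 1 < z ->
  measurable (D : set (measurableTypeR R * measurableTypeR R)) ->
  (forall x t, D x -> 0 <= t <= 1 -> D (homothety R o t x)) ->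
  (\int[lebesgue2 R]_x (\1_D x * P.[x.1, x.2] ^+ 2)%R%:E <=
   (z ^+ (4 * p + 2))%:E * \int[lebesgue2 R]_x
     (\1_D (homothety R o (4 * z / (z + 1) ^+ 2)^-1 x) * P.[x.1, x.2] ^+ 2)%R%:E)%E.
Proof.
move=> sP sYP z1 mD starD; set l := 4 * z / (z + 1) ^+ 2.
have [t [w [tP w0 wle sqrP]]] := sqr_le_sum_homothety R p P z sP sYP z1.
have l0 : 0 < l.
  by rewrite divr_gt0// ?exprn_gt0//; lra.
have mP : measurable_fun [set: measurableTypeR R * measurableTypeR R]
    (fun x : measurableTypeR R * measurableTypeR R => P.[x.1, x.2] ^+ 2 : R).
  by apply: measurable_funX; exact: measurable_horner2.
(* The indicator is that of the image of D under the homothety of ratio l, expressed through the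
   inverse map. *)
pose F (x : measurableTypeR R * measurableTypeR R) : \bar R :=
  (\1_D (homothety R o l^-1 x) * P.[x.1, x.2] ^+ 2)%:E.
have F0 x : (0 <= F x)%E by rewrite lee_fin mulr_ge0// sqr_ge0.
have mF : measurable_fun setT F.
  apply/measurable_EFinP; apply: measurable_funM => //.
  apply: (measurableT_comp (f := \1_D : measurableTypeR R * measurableTypeR R -> R)).
    exact: measurable_indic.
  exact: measurable_homothety.
have mFt s : measurable_fun [set: measurableTypeR R * measurableTypeR R]
    (fun x => F (homothety R o s x)).
  exact: (measurableT_comp mF (measurable_homothety R o s)).
pose G (k : 'I_(4 * p + 2).+1) (x : measurableTypeR R * measurableTypeR R) : \bar R :=
  ((w k * t k ^+ 2)%:E * F (homothety R o (t k) x))%E.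
have c0 k : 0 <= w k * t k ^+ 2 by rewrite mulr_ge0// sqr_ge0.
have G0 k x : (0 <= G k x)%E by rewrite mule_ge0// lee_fin.
have mG k : measurable_fun setT (G k) by exact: measurable_funeM.
have step1 : (\int[lebesgue2 R]_x (\1_D x * P.[x.1, x.2] ^+ 2)%R%:E <=
    \int[lebesgue2 R]_x \sum_k G k x)%E.
  apply: nnintegral_le => x; first by rewrite lee_fin mulr_ge0// sqr_ge0.
  rewrite indicE; have [/set_mem Dx|_] := boolP (x \in D); last first.
    by rewrite mul0r sume_ge0.
  rewrite mul1r /G; under eq_bigr do rewrite -EFinM.
  rewrite sumEFin lee_fin (le_trans (sqrP o x))//; apply: ler_sum => k _.
  (* The composite homothety has ratio t_k / l, which lies in [0, 1], so it keeps [x] in D. *)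
  rewrite homothetyM indicE mem_set ?mul1r ?mulrA//.
  apply: starD => //; have /andP[tk0 tkl] := tP k.
  by rewrite mulr_ge0 ?invr_ge0 ?(ltW l0)//= ler_pdivrMl// mulr1.
apply: (le_trans step1); rewrite ge0_integral_sum//.
apply: (@le_trans _ _ (\sum_k (w k)%:E * \int[lebesgue2 R]_x F x)%E).
  apply: lee_sum => k _; rewrite ge0_integralZl_EFin//.
  (* A node t_k = 0 admits no change of variables, but the factor t_k^2 makes its term vanish. *)
  have /andP[+ _] := tP k; rewrite le_eqVlt => /predU1P[<-|tk0].
    rewrite expr0n mulr0 mul0e mule_ge0// ?lee_fin//; exact: integral_ge0.
  by rewrite EFinM -muleA (integral_affine2 R ((1 - t k) * o.1, (1 - t k) * o.2) _ F tk0).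
rewrite -ge0_sume_distrl; last by move=> k _; rewrite lee_fin.
rewrite sumEFin lee_wpmul2r ?lee_fin//; exact: integral_ge0.
Qed.

Theorem lemma2p5 (R : realType) (D : set (R * R)) (hD : is_triangle D)
    (delta : R) (hdelta0 : 0 < delta) (hdelta : delta < inradius D / 2)
    (p : nat) (hp : (1 <= p)%N) (v : R * R -> R) (hv : Qp p D v) :
  (L2norm D v <=
     ((1 + 7 * Num.sqrt (delta / inradius D)) `^ (2 * p%:R + 3 / 2))%:E
       * L2norm (inner_set D delta) v)%E.
Proof.
have L2E A : L2norm A v = ((\int[lebesgue2 R]_x (\1_A x * v x ^+ 2)%R%:E) `^ 2^-1)%E.
  rewrite /L2norm unlock; congr (_ `^ _)%E; apply: eq_integral => x _.
  rewrite patchE indicE; case: ifPn => _; last by rewrite mul0r abse0 poweR0r.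
  by rewrite /= mul1r powR_mulrn// real_normK// num_real.
case: hv => P [sP sYP vP].
case: hD => a [b [c [ncol DE]]].
set rho := inradius D in hdelta *.
set s := Num.sqrt (delta / rho).
have rho0 : 0 < rho by lra.
have s0 : 0 < s by rewrite sqrtr_gt0 divr_gt0.
have s2 : s ^+ 2 = delta / rho by rewrite sqr_sqrtr// divr_ge0// ltW.
(* From delta < rho / 2, as 1/2 < 25/49. *)
have s57 : s < 5 / 7.
  suff : s ^+ 2 < 1 / 2 by rewrite expr2 => h; nra.
  by rewrite s2 ltr_pdivrMr//; lra.
set z := 1 + 7 * s.
have z1 : 1 < z by rewrite /z; lra.
set l := 4 * z / (z + 1) ^+ 2.
have l0 : 0 < l by rewrite divr_gt0// ?exprn_gt0//; lra.
have lE : 1 - l = (7 * s / (2 + 7 * s)) ^+ 2.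
  by rewrite /l /z; field; apply/eqP; lra.
(* After taking roots this reads s (2 + 7s) < 7s, that is, s < 5/7. *)
have sl : s ^+ 2 < 1 - l.
  rewrite lE ltrXn2r// ?nnegrE ?divr_ge0//; try lra.
  by rewrite ltr_pdivlMr; nra.
have l1 : 0 < 1 - l by apply: le_lt_trans sl; exact: sqr_ge0.
(* The radius delta / (1 - l) is below rho because delta / rho = s^2 < 1 - l; a disk of larger
   radius leaves room for the margin delta. *)
have [|r [ o [xr ballD]]] := inradius_ball R D (delta / (1 - l)).
  rewrite divr_gt0//= ltr_pdivrMr//.
  by move: sl; rewrite s2 ltr_pdivrMr// mulrC.
have dr : delta < (1 - l) * r by rewrite mulrC -ltr_pdivrMr.
have r0 : 0 < r by apply: lt_trans xr; exact: divr_gt0.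
have Do : D o.
  by apply: ballD; rewrite /= /Defs.edist !subrr expr0n addr0 sqrtr0 ltW.
have starD x t : D x -> 0 <= t <= 1 -> D (homothety R o t x).
  by move: Do; rewrite DE => Do Dx t01; exact: triangle_hull_homothety.
have mD : measurable (D : set (measurableTypeR R * measurableTypeR R)).
  by rewrite DE; exact: measurable_triangle_hull.
have := integral_sqr_homothety R p P z D o sP sYP z1 mD starD.
rewrite -/l => main.
have sub x : D (homothety R o l^-1 x) -> inner_set D delta x.
  have l0' : l != 0 by rewrite gt_eqF.
  move=> Dx; rewrite -[x](homothety1 R o) -(divff l0') -homothetyM.
  rewrite DE in Dx ballD Do *.
  apply: (@homothety_inner_set R a b c o _ delta r l) => //.
    by apply/andP; split; lra.
  exact: lt_trans dr.
have main2 : (\int[lebesgue2 R]_x (\1_D x * v x ^+ 2)%R%:E <=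
  (z ^+ (4 * p + 2))%:E *
    \int[lebesgue2 R]_x (\1_(inner_set D delta) x * v x ^+ 2)%R%:E)%E.
  have -> : (\int[lebesgue2 R]_x (\1_D x * v x ^+ 2)%R%:E =
      \int[lebesgue2 R]_x (\1_D x * P.[x.1, x.2] ^+ 2)%R%:E)%E.
    apply: eq_integral => x _; rewrite indicE.
    by have [/set_mem Dx|_] := boolP (x \in D); [rewrite vP|rewrite !mul0r].
  apply: (le_trans main); apply: lee_wpmul2l.
    by rewrite lee_fin exprn_ge0//; lra.
  (* On the image of D, which lies in the inner set and hence in D, the polynomial equals [v];
     elsewhere the left integrand is 0. *)
  apply: nnintegral_le => x; first by rewrite lee_fin mulr_ge0// sqr_ge0.
  rewrite !indicE; have [/set_mem Dx|_] := boolP (_ \in D); last first.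
    by rewrite mul0r lee_fin mulr_ge0// sqr_ge0.
  by have Ex := sub _ Dx; rewrite (mem_set Ex) vP//; exact: Ex.1.
rewrite !L2E.
have I0 A : (0 <= \int[lebesgue2 R]_x (\1_A x * v x ^+ 2)%R%:E)%E.
  by apply: integral_ge0 => x _; rewrite lee_fin mulr_ge0// sqr_ge0.
have zn0 : 0 <= z ^+ (4 * p + 2) by rewrite exprn_ge0//; lra.
apply: (@le_trans _ _ (((z ^+ (4 * p + 2))%:E *
    \int[lebesgue2 R]_x (\1_(inner_set D delta) x * v x ^+ 2)%R%:E) `^ 2^-1)%E).
  by apply: gt0_ler_poweR => //; rewrite in_itv/= ?leey ?andbT ?mule_ge0.
rewrite poweRM// lee_wpmul2r ?poweR_ge0// poweR_EFin lee_fin.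
(* The square root of z^(4p + 2) is z^(2p + 1), and 2p + 1 is at most 2p + 3/2 while z > 1. *)
rewrite -powR_mulrn; last lra.
rewrite -powRrM; apply: ler_powR; first lra.
by rewrite natrD natrM; lra.
Qed.
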